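(* Let $q$ be a power of two and let $n>1$ be an integer. Then \[ |\mathcal{I}(x^3+x^2,\,1,\,n,\,q)|=\frac{1}{3n_3}\Bigl(I\bigl(n/n_3,q^{n_3}\bigr)-I\bigl(n/n_3,\varepsilon\bigr)\Bigr), \] where $\varepsilon=\left(\frac{q}{3}\right)$ is the Legendre symbol.
   Context: For coprime $g,h\in\mathbb{F}_q[x]$ and an integer $n>1$, $\mathcal{I}(g,h,n,q)$ denotes the set of monic irreducible polynomials $f\in\mathbb{F}_q[x]$ of degree $n$ such that $h(x)^n f\bigl(g(x)/h(x)\bigr)$ is irreducible in $\mathbb{F}_q[x]$. $n_3$ denotes the largest power of $3$ dividing $n$. For a positive integer $k$ and any integer $Q$ (not necessarily a prime power, possibly negative), $I(k,Q)=\frac1k\sum_{d\mid k}\mu(d)Q^{k/d}$, where $\mu$ is the Möbius function. The Legendre symbol $\varepsilon=\left(\frac{q}{3}\right)$ equals $1$ if $q\equiv 1\pmod 3$ and $-1$ if $q\equiv -1\pmod 3$. *)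

(* Defs.v *)
From mathcomp Require Import all_boot all_order all_algebra.

Set Implicit Arguments.
Unset Strict Implicit.
Unset Printing Implicit Defensive.

Import GRing.Theory.
Local Open Scope ring_scope.

(* The polynomial h(x)^n f(g(x)/h(x)), for f of degree at most n, written with
   denominators cleared; [hcompE] relates it to the fraction field. *)
Definition hcomp (F : fieldType) (g h : {poly F}) (n : nat) (f : {poly F}) :
    {poly F} :=
  \sum_(i < n.+1) f`_i *: (g ^+ i * h ^+ (n - i)).

Local Notation "x %:F" := (tofrac x).

Lemma hcompE (F : fieldType) (g h : {poly F}) (n : nat) (f : {poly F}) :
  h != 0 -> (size f <= n.+1)%N ->
  (hcomp g h n f)%:F =
    h%:F ^+ n * (map_poly (fun c => c%:P%:F) f).[g%:F / h%:F].
Proof.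
move=> h0 sf; have hF0 : h%:F != 0 by rewrite tofrac_eq0.
rewrite /hcomp rmorph_sum (@horner_coef_wide _ n.+1); last first.
  exact: leq_trans (size_poly _ _) sf.
rewrite mulr_sumr; apply: eq_bigr => i _.
rewrite coef_map_id0 ?rmorph0 // -mul_polyC !rmorphM !rmorphXn /=.
have -> : h%:F ^+ n = h%:F ^+ (n - i) * h%:F ^+ i.
  by rewrite -exprD subnK // -ltnS.
rewrite exprMn exprVn [RHS]mulrCA; congr (_ * _).
rewrite [LHS]mulrC -mulrA; congr (_ * _).
by rewrite mulrCA mulfV ?expf_neq0 ?mulr1.
Qed.

(* The set I(g, h, n, q) with q = #|F|. Polynomials of degree n are taken in
   the finite type of polynomials of size at most n.+1. *)
Definition Iset (F : finFieldType) (g h : {poly F}) (n : nat) :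
    {set {poly_n.+1 F}} :=
  [set f : {poly_n.+1 F} |
    [&& size (f : {poly F}) == n.+1, (f : {poly F}) \is monic,
        irreducibleb (f : {poly F}) & irreducibleb (hcomp g h n f)]].

(* Meaningful for positive n only. *)
Definition mobius (n : nat) : int :=
  if all (fun p => logn p n == 1%N) (primes n) then (-1) ^+ size (primes n)
  else 0.

Definition Inum (k : nat) (Q : int) : rat :=
  k%:R^-1 * (\sum_(d <- divisors k) mobius d * Q ^+ (k %/ d))%:~R.

(* Meaningful for an odd prime p only. *)
Definition legendre (a p : nat) : int :=
  if (p %| a)%N then 0
  else if [exists x : 'I_p, x ^ 2 == a %[mod p]]%N then 1 else -1.

Lemma legendre3_1 (q : nat) : q = 1 %[mod 3] -> legendre q 3 = 1.
Proof.
move=> h; rewrite /legendre /dvdn h /=; case: existsP => // - [].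
by exists (inord 1); rewrite inordK // h.
Qed.

Lemma legendre3_2 (q : nat) : q = 2 %[mod 3] -> legendre q 3 = -1.
Proof.
move=> h; rewrite /legendre /dvdn h /=; case: existsP => // - [x].
by case: x => -[|[|[]]].
Qed.

(* Main.v *)
Require Import Defs.
From mathcomp Require Import all_boot all_order all_algebra.
From mathcomp Require Import all_solvable all_field.
From mathcomp Require Import zify ring.
From HB Require Import structures.
Set Implicit Arguments.
Unset Strict Implicit.
Unset Printing Implicit Defensive.
Import GRing.Theory.
Local Open Scope ring_scope.

(** Let [K] be an algebraic closure of [F], [#|F| = q], [g = 'X^3 + 'X^2], and
    call degree of [x : K] the period of [x] under the Frobenius map
    [x |-> x ^+ q]; it is the degree of the minimal polynomial of [x] over [F].

    A monic irreducible [f] of degree [n] is the minimal polynomial of its roots, so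
    [f \Po g], of degree [3 * n], is irreducible exactly when its roots have
    degree [3 * n]. Hence [3 * n] times the cardinal sought is the number of
    [x : K] of degree [3 * n] such that [g.[x]] has degree [n]
    ([card_Iset_comp]).

    These [x] are counted by sieving over the divisors of [n]. An [x] is called
    [j]-nonsplit when [g.[x]] lies in the field with [q ^ j] elements and [x]
    lies in its cubic extension but not in it, i.e., when [x] is a root of an
    irreducible cubic [g - a] over that field. Since [g] has degree 3, the
    degree of [x] is 1, 2 or 3 times the degree [d] of [g.[x]], and [x] is
    [j]-nonsplit if and only if this factor is 3, [d] divides [j] and 3 does
    not divide [j / d] ([cubic_nonsplitE]). Writing [n = w * m] with [w] the
    3-part of [n], the number of [(w * j)]-nonsplit elements is therefore, for
    [j %| m], a sum over the divisors of [j] ([count_cubic_nonsplit]), to be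
    inverted by Moebius inversion ([mobius_inversion]).

    There remains to see that there are [Q - e] [j]-nonsplit elements, where
    [Q = q ^ j] and [e = 1] or [-1] is congruent to [Q] modulo 3
    ([card_cubic_nonsplit]). This is where characteristic 2 enters: for
    [x = 1 + z + z^-1] one has [x ^+ 3 + x ^+ 2 = z ^+ 3 + z ^- 3]
    ([cubic_addV]), which is the functional equation of the third Dickson
    polynomial. Whether [u + u^-1] lies in a given finite subfield is read off
    from the multiplicative order of [u] ([addV_fixed]), and [x] is nonsplit
    exactly when [z ^ (3 * (Q - e)) = 1] and [z ^ (Q - e) != 1]
    ([cubic_addV_nonsplit]).
    There are [2 * (Q - e)] such [z], two for each [x], namely [z] and
    [z^-1]. Finally [e] is the [j]-th power of the Legendre symbol of [q],
    unchanged when [j] is multiplied by the odd number [w]. *)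

(** * Double counting *)

(** Both sides count the pairs in the relation [R]; with [a = 1] it gives the
    size of the source of a map all of whose fibres have [b] elements. *)
Lemma double_count (S T : eqType) (s : seq S) (t : seq T)
    (R : S -> T -> bool) (a b : nat) :
    {in s, forall x, count (R x) t = a} ->
    {in t, forall y, count (R^~ y) s = b} ->
  (size s * a = size t * b)%N.
Proof.
move=> rowE colE.
have sumE (U : eqType) (u : seq U) (c : nat) (f : U -> nat) :
    {in u, forall x, f x = c} -> (\sum_(x <- u) f x = size u * c)%N.
  by move=> fE; rewrite (eq_big_seq _ fE) big_const_seq count_predT
     iter_addn_0 mulnC.
rewrite -(sumE _ _ _ _ rowE) -(sumE _ _ _ _ colE).
under eq_bigr do rewrite -sum1_count big_mkcond.
rewrite exchange_big; apply: eq_bigr => y _.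
by rewrite -big_mkcond /= sum1_count.
Qed.

(** * Moebius inversion *)

Lemma mobius1 : mobius 1 = 1.
Proof. by []. Qed.

Lemma mobius_prime_mul (p c : nat) : prime p -> (0 < c)%N ->
  mobius (p * c) = if (p %| c)%N then 0 else - mobius c.
Proof.
move=> p_pr c_gt0; have p_gt0 := prime_gt0 p_pr.
have logpc r : prime r -> logn r (p * c) = ((r == p) + logn r c)%N.
  by move=> r_pr; rewrite lognM // logn_prime // eq_sym.
have memP r : (r \in primes (p * c)) = (r == p) || (r \in primes c).
  by rewrite primesM // primes_prime // inE.
rewrite /mobius; case: (boolP (p %| c)%N) => [p_dv_c | pNdv_c].
  case: ifP => // /allP /(_ p); rewrite memP eqxx logpc // eqxx => /(_ isT).
  have : (0 < logn p c)%N by rewrite logn_gt0 mem_primes p_pr c_gt0.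
  by case: (logn p c).
have p_notin : p \notin primes c by rewrite mem_primes p_pr c_gt0.
have perm_pc : perm_eq (primes (p * c)) (p :: primes c).
  by apply: uniq_perm => [||r]; rewrite /= ?p_notin ?primes_uniq // memP inE.
rewrite (perm_all _ perm_pc) (perm_size perm_pc) /= logpc // eqxx.
have -> : logn p c = 0%N.
  by apply/eqP; rewrite -leqn0 leqNgt logn_gt0.
rewrite addn0 eqxx /= exprS mulN1r.
have -> : all (fun r => logn r (p * c) == 1%N) (primes c) =
          all (fun r => logn r c == 1%N) (primes c).
  apply: eq_in_all => r r_c.
  have r_pr : prime r by move: r_c; rewrite mem_primes => /andP[].
  rewrite (logpc _ r_pr).
  by case: (eqVneq r p) r_c => [-> | //]; rewrite (negPf p_notin).
by case: ifP => //; rewrite oppr0.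
Qed.

(** For a prime [p] dividing [m], the divisors [p * c] with [c] prime to [p]
    cancel the divisors [c], and the divisors [p * c] with [p %| c]
    contribute 0. *)
Lemma sum_mobius_divisors (m : nat) : (0 < m)%N ->
  \sum_(d <- divisors m) mobius d = (m == 1%N)%:R.
Proof.
move=> m_gt0; case: eqVneq => [-> | m_neq1]; first by rewrite big_seq1 mobius1.
have p_pr : prime (pdiv m) by apply: pdiv_prime; rewrite ltn_neqAle eq_sym m_neq1.
have p_dv : (pdiv m %| m)%N := pdiv_dvd m.
move: (pdiv m) p_pr p_dv => p p_pr p_dv.
have p_gt0 := prime_gt0 p_pr.
rewrite (bigID (fun d => p %| d)%N) /=.
have -> : \sum_(d <- divisors m | (p %| d)%N) mobius d =
          \sum_(c <- divisors (m %/ p)) mobius (p * c).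
  rewrite -[LHS]big_filter -(big_map (muln p) xpredT).
  apply: perm_big; apply: uniq_perm.
  - by rewrite filter_uniq ?divisors_uniq.
  - rewrite map_inj_uniq ?divisors_uniq // => a b /eqP.
    by rewrite eqn_pmul2l // => /eqP.
  have mp_gt0 : (0 < m %/ p)%N by rewrite divn_gt0 // dvdn_leq.
  move=> d; rewrite mem_filter -dvdn_divisors //.
  apply/andP/mapP => [[/dvdnP[c ->]] | [c]].
    move=> cp_m; exists c; last by rewrite mulnC.
    by rewrite -dvdn_divisors // dvdn_divRL.
  by rewrite -dvdn_divisors // dvdn_divRL // => cp_m ->; rewrite mulnC dvdn_mull.
have -> : \sum_(c <- divisors (m %/ p)) mobius (p * c) =
          \sum_(c <- divisors (m %/ p) | ~~ (p %| c)%N) - mobius c.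
  rewrite [RHS]big_mkcond [LHS]big_seq [RHS]big_seq; apply: eq_bigr => c.
  rewrite -dvdn_divisors ?divn_gt0 // ?(dvdn_leq _ p_dv) // => c_dv.
  rewrite mobius_prime_mul ?if_neg //; apply: dvdn_gt0 c_dv.
  by rewrite divn_gt0 ?(dvdn_leq _ p_dv).
rewrite sumrN addrC; apply/eqP; rewrite subr_eq0; apply/eqP.
rewrite -[LHS]big_filter -[RHS]big_filter; apply: perm_big; apply: uniq_perm.
- by rewrite filter_uniq ?divisors_uniq.
- by rewrite filter_uniq ?divisors_uniq.
move=> d; rewrite !mem_filter -!dvdn_divisors ?divn_gt0 ?(dvdn_leq _ p_dv) //.
case: (boolP (p %| d)%N) => //= pNdv_d.
rewrite -{1}(divnK p_dv) Gauss_dvdl // coprime_sym.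
by rewrite prime_coprime.
Qed.

(** Only the values of [c] at the divisors of [m] are constrained: in the
    application the formula for [c j] fails when [3 %| j]. *)
Lemma mobius_inversion (b c : nat -> int) (m : nat) :
    (0 < m)%N ->
    (forall j, (j %| m)%N -> c j = \sum_(e <- divisors j) b e) ->
  \sum_(d <- divisors m) mobius d * c (m %/ d)%N = b m.
Proof.
move=> m_gt0 cE.
have -> : \sum_(d <- divisors m) mobius d * c (m %/ d)%N =
    \sum_(d <- divisors m) \sum_(e <- divisors m | (e * d %| m)%N)
      mobius d * b e.
  rewrite [LHS]big_seq [RHS]big_seq; apply: eq_bigr => d.
  rewrite -dvdn_divisors // => d_dv.
  have d_gt0 := dvdn_gt0 m_gt0 d_dv.
  rewrite cE ?dvdn_div // mulr_sumr -[RHS]big_filter; apply: perm_big.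
  apply: uniq_perm => [||e]; rewrite ?filter_uniq ?divisors_uniq //.
  rewrite mem_filter -!dvdn_divisors ?divn_gt0 ?(dvdn_leq _ d_dv) //.
  rewrite dvdn_divRL //; apply/idP/andP => [ed_m | []//]; split=> //.
  exact: dvdn_trans (dvdn_mulr _ _) ed_m.
have -> : \sum_(d <- divisors m) \sum_(e <- divisors m | (e * d %| m)%N)
      mobius d * b e =
    \sum_(e <- divisors m) (\sum_(d <- divisors (m %/ e)) mobius d) * b e.
  rewrite (exchange_big_dep xpredT) //= [LHS]big_seq [RHS]big_seq.
  apply: eq_bigr => e; rewrite -dvdn_divisors // => e_dv.
  have e_gt0 := dvdn_gt0 m_gt0 e_dv.
  rewrite mulr_suml -[LHS]big_filter; apply: perm_big.
  apply: uniq_perm => [||d]; rewrite ?filter_uniq ?divisors_uniq //.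
  rewrite mem_filter -!dvdn_divisors ?divn_gt0 ?(dvdn_leq _ e_dv) //.
  rewrite dvdn_divRL // mulnC; apply/andP/idP => [[]// | de_m]; split=> //.
  exact: dvdn_trans (dvdn_mulr _ _) de_m.
rewrite (bigD1_seq m) ?divisors_uniq ?divisors_id //= divnn m_gt0 big_seq1.
rewrite mobius1 mul1r big_seq_cond big1 ?addr0 // => e /andP[].
rewrite -dvdn_divisors // => e_dv e_neq.
have e_gt0 := dvdn_gt0 m_gt0 e_dv.
rewrite sum_mobius_divisors ?divn_gt0 ?(dvdn_leq _ e_dv) // eq_sym eqn_div //.
rewrite mul1n.
by rewrite (negPf e_neq) mul0r.
Qed.

(** * Periodic points and irreducibility *)

Lemma inj_iter (T : Type) (f : T -> T) (n : nat) :
  injective f -> injective (iter n f).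
Proof. by move=> f_inj; elim: n => // n IH x y /f_inj /IH. Qed.

(** A polynomial has fewer roots than its size, so by the pigeonhole principle
    two of the first [size p] iterates of [x] coincide, and by injectivity one
    can go back to [x]. *)
Lemma iter_root_periodic (K : idomainType) (tau : K -> K) (p : {poly K})
    (x : K) :
    injective tau -> p != 0 -> (forall i, root p (iter i tau x)) ->
  exists2 i, (0 < i < size p)%N & iter i tau x = x.
Proof.
move=> tau_inj p_neq0 p_root.
have p_size : (0 < size p)%N by rewrite size_poly_gt0.
have : ~~ uniq (traject tau x (size p)).
  apply/negP => s_uniq.
  have : (size (traject tau x (size p)) < size p)%N.
    apply: max_poly_roots => //; apply/allP => y /trajectP[i _ ->]; exact: p_root.
  by rewrite size_traject ltnn.
rewrite -(prednK p_size) looping_uniq negbK => /trajectP[i lt_i eq_i].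
exists ((size p).-1 - i)%N; first by lia.
apply: (@inj_iter _ tau i tau_inj); rewrite -iterD subnKC ?eq_i //; exact: ltnW.
Qed.

(** In a factorization [p = t * s], [x] is a root of [t] or of [s], and that
    factor has the size of [p]. *)
Lemma irreducible_minimal_root (F K : fieldType) (io : {rmorphism F -> K})
    (p r : {poly F}) (x : K) :
    p != 0 -> root (map_poly io p) x -> (1 < size r)%N ->
    (forall s, root (map_poly io s) x -> r %| s) -> size p = size r ->
  irreducible_poly p.
Proof.
move=> p_neq0 p_x r_gt1 r_dv p_size; split=> [|s s_neq1 s_dv_p].
  by rewrite p_size.
have [t pE] := dvdpP _ _ s_dv_p.
have [t_neq0 s_neq0] : t != 0 /\ s != 0.
  by move: p_neq0; rewrite pE mulf_eq0 negb_or => /andP.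
have s_gt0 : (0 < size s)%N by rewrite size_poly_gt0.
have t_gt0 : (0 < size t)%N by rewrite size_poly_gt0.
have sizeE : size r = (size t + size s).-1 by rewrite -p_size pE size_mul.
rewrite -dvdp_size_eqp // p_size; apply/eqP.
have s_size : size s <> 1%N by exact/eqP.
move: p_x; rewrite pE rmorphM rootM => /orP[] /r_dv r_dvd.
  have le_rt : (size r <= size t)%N := dvdp_leq t_neq0 r_dvd.
  by clear -sizeE le_rt s_size s_gt0 t_gt0; lia.
have le_rs : (size r <= size s)%N := dvdp_leq s_neq0 r_dvd.
by clear -sizeE le_rs s_size s_gt0 t_gt0; lia.
Qed.

(** * Degrees over a finite field *)

Section Frobenius.

Variables (F : finFieldType) (K : fieldType) (io : {rmorphism F -> K}).

(** The embedding is an argument because it is what makes this map additive: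
    without it nothing relates [#|F|] to the characteristic of [K]. *)
Definition frob of {rmorphism F -> K} := fun x : K => x ^+ #|F|.

Lemma card_pchar_nat : [pchar K].-nat #|F|.
Proof.
have [p _ pcharFp] := finPcharP F.
have /abelem_pgroup := fin_ring_pchar_abelem pcharFp.
rewrite /pgroup cardsT; apply: sub_in_pnat => r _ /eqP ->.
by rewrite (fmorph_pchar io).
Qed.

Fact frob_is_zmod_morphism : zmod_morphism (frob io).
Proof.
have frobD : {morph frob io : x y / x + y}.
  by move=> x y; rewrite /frob exprDn_pchar ?card_pchar_nat.
by move=> x y; apply/eqP; rewrite eq_sym subr_eq -frobD subrK.
Qed.

Fact frob_is_monoid_morphism : monoid_morphism (frob io).
Proof. by split; [exact: expr1n | move=> x y; exact: exprMn]. Qed.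

HB.instance Definition _ :=
  GRing.isZmodMorphism.Build K K (frob io) frob_is_zmod_morphism.
HB.instance Definition _ :=
  GRing.isMonoidMorphism.Build K K (frob io) frob_is_monoid_morphism.

Lemma iter_frob i x : iter i (frob io) x = x ^+ (#|F| ^ i).
Proof. by elim: i => // i IH; rewrite iterS IH /frob -exprM expnSr. Qed.

(** The [q] elements of [F] already account for all the roots of ['X^q - 'X]. *)
Lemma frob_fixed_image x : frob io x = x -> exists a, x = io a.
Proof.
move=> x_fixed; suff /mapP[a _ ->] : x \in [seq io a | a <- enum F] by exists a.
rewrite -root_prod_XsubC big_map big_enum /=.
have -> : \prod_(a in F) ('X - (io a)%:P) = map_poly io ('X^#|F| - 'X).
  rewrite finField_genPoly rmorph_prod; apply: eq_bigr => a _.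
  by rewrite rmorphB /= map_polyX map_polyC.
rewrite rmorphB /= map_polyXn map_polyX rootE !hornerE.
by rewrite -[x ^+ _]/(frob io x) x_fixed subrr.
Qed.

Lemma frob_fixed_poly (r : {poly K}) :
  map_poly (frob io) r = r -> exists p, r = map_poly io p.
Proof.
move=> r_fixed; pose g y := odflt 0 [pick a | io a == y].
have gE i : io (g r`_i) = r`_i.
  have [|a rE] := @frob_fixed_image r`_i; first by rewrite -coef_map r_fixed.
  by rewrite /g; case: pickP => [b /eqP // | /(_ a)]; rewrite rE eqxx.
exists (\poly_(i < size r) g r`_i); apply/polyP=> i; rewrite coef_map coef_poly.
by case: ltnP => [_ | le_i]; [exact/esym/gE | rewrite raddf0 nth_default].
Qed.

Lemma map_frob_poly (p : {poly F}) :
  map_poly (frob io) (map_poly io p) = map_poly io p.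
Proof.
apply/polyP=> i; rewrite !coef_map /= /frob -rmorphXn; congr (io _).
exact: expf_card.
Qed.

Lemma root_frob (p : {poly F}) x i :
  root (map_poly io p) x -> root (map_poly io p) (x ^+ (#|F| ^ i)).
Proof.
move=> p_x; rewrite -iter_frob; elim: i => //= i IH.
by rewrite -map_frob_poly fmorph_root.
Qed.

Hypothesis io_alg : integralRange io.

Fact frob_periodic (x : K) : exists i, (0 < i)%N && (x ^+ (#|F| ^ i) == x :> K).
Proof.
have [p p_monic p_x] := io_alg x.
have [||i|i /andP[i_gt0 _] xi] :=
  @iter_root_periodic _ (frob io) (map_poly io p) x.
- exact: fmorph_inj.
- by rewrite map_poly_eq0 monic_neq0.
- by rewrite iter_frob root_frob.
by exists i; rewrite i_gt0 -iter_frob xi eqxx.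
Qed.

(** The period of [x] under Frobenius, which is the degree of [F(x)] over [F]
    (see [size_conj_poly] and [conj_polyP]). *)
Definition degree x := ex_minn (frob_periodic x).

Lemma degree_gt0 x : (0 < degree x)%N.
Proof. by rewrite /degree; case: ex_minnP => i /andP[]. Qed.

Lemma degreeP x i : (x ^+ (#|F| ^ i) == x) = (degree x %| i)%N.
Proof.
rewrite /degree; case: ex_minnP => d /andP[d_gt0 /eqP x_d] d_min.
have x_mul c : x ^+ (#|F| ^ (c * d)) = x.
  by elim: c => [|c IH]; rewrite ?expn0 // mulSn expnD exprM x_d.
rewrite /dvdn {1}(divn_eq i d) expnD exprM x_mul.
case: (posnP (i %% d)) => [-> | id_gt0]; first by rewrite eqxx.
apply/negP => x_id.
have /d_min : (0 < i %% d)%N && (x ^+ (#|F| ^ (i %% d)) == x).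
  by rewrite id_gt0.
by rewrite leqNgt ltn_mod d_gt0.
Qed.

Definition conjugates x := [seq x ^+ (#|F| ^ i) | i <- iota 0 (degree x)].

Lemma conjugates_uniq x : uniq (conjugates x).
Proof.
rewrite map_inj_in_uniq ?iota_uniq // => i j; rewrite !mem_iota /= !add0n.
wlog le_ij : i j / (i <= j)%N.
  move=> H; case/orP: (leq_total i j) => le lti ltj eq; first exact: H.
  by rewrite (H j i).
move=> _ lt_j eq_ij; suff : (degree x %| j - i)%N.
  move=> dv; apply/eqP; rewrite eqn_leq le_ij /= -subn_eq0.
  by case: (posnP (j - i)) => [// | ij_gt0]; have := dvdn_leq ij_gt0 dv; lia.
rewrite -degreeP; apply/eqP; apply: (@inj_iter _ (frob io) i (fmorph_inj _)).
by rewrite !iter_frob -exprM -expnD subnK // eq_ij.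
Qed.

Definition conj_poly x := \prod_(y <- conjugates x) ('X - y%:P).

Lemma size_conj_poly x : size (conj_poly x) = (degree x).+1.
Proof. by rewrite size_prod_XsubC size_map size_iota. Qed.

Lemma conj_poly_monic x : conj_poly x \is monic.
Proof. exact: monic_prod_XsubC. Qed.

Lemma root_conj_poly x : root (conj_poly x) x.
Proof.
rewrite root_prod_XsubC; apply/mapP; exists 0%N; last by rewrite expr1.
by rewrite mem_iota degree_gt0.
Qed.

Lemma conj_poly_dvdp (p : {poly F}) x :
  root (map_poly io p) x -> conj_poly x %| map_poly io p.
Proof.
move=> p_x; apply: uniq_roots_dvdp; last by rewrite uniq_rootsE conjugates_uniq.
by apply/allP=> y /mapP[i _ ->]; exact: root_frob.
Qed.

(** Frobenius permutes the conjugates of [x] cyclically, so it fixes the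
    coefficients of [conj_poly x]. *)
Lemma conj_polyP x : exists p, conj_poly x = map_poly io p.
Proof.
apply: frob_fixed_poly; rewrite /conj_poly rmorph_prod /=.
under eq_bigr do rewrite rmorphB /= map_polyX map_polyC /=.
rewrite !big_map -(prednK (degree_gt0 x)).
(* Split the last factor off on the left and the first one on the right: they
   agree because the Frobenius map closes the cycle. *)
rewrite -{1}[(degree x).-1.+1]addn1 iotaD big_cat big_seq1 add0n /=.
rewrite -[iota 1 _]/(iota (1 + 0) _) iotaDl big_cons big_map [RHS]mulrC.
have -> : frob io (x ^+ (#|F| ^ (degree x).-1)) = x ^+ (#|F| ^ 0).
  rewrite /frob -exprM -expnSr prednK ?degree_gt0 // expn0 expr1.
  by apply/eqP; rewrite degreeP.
congr (_ * _); apply: eq_bigr => i _.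
by rewrite /frob -exprM -expnSr add1n.
Qed.

(** [conj_poly x] is the minimal polynomial of [x] over [F], hence divides [p];
    [p] is irreducible when there is no room for a cofactor. *)
Lemma irreducible_degree (p : {poly F}) x :
    p != 0 -> root (map_poly io p) x ->
  irreducibleb p = (size p == (degree x).+1).
Proof.
move=> p_neq0 p_x; have [r rE] := conj_polyP x.
have r_size : size r = (degree x).+1 by rewrite -size_conj_poly rE size_map_poly.
have r_dv s : root (map_poly io s) x -> r %| s.
  by move=> /conj_poly_dvdp; rewrite rE dvdp_map.
apply/irreducibleP/eqP => [[p_gt1 p_irr] | p_size].
  rewrite -r_size; apply/esym/eqp_size/p_irr; last exact: r_dv.
  by rewrite r_size eqSS -lt0n degree_gt0.
apply: (irreducible_minimal_root p_neq0 p_x _ r_dv); rewrite r_size //.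
by rewrite ltnS degree_gt0.
Qed.

Lemma monic_root_inj (p r : {poly F}) x :
    p \is monic -> r \is monic ->
    size p = (degree x).+1 -> size r = (degree x).+1 ->
    root (map_poly io p) x -> root (map_poly io r) x -> p = r.
Proof.
have key (s : {poly F}) : s \is monic -> size s = (degree x).+1 ->
    root (map_poly io s) x -> map_poly io s = conj_poly x.
  move=> s_monic s_size /conj_poly_dvdp s_dv; apply/eqP; rewrite eq_sym.
  rewrite -eqp_monic ?conj_poly_monic ?map_monic //.
  by rewrite -dvdp_size_eqp // size_conj_poly size_map_poly s_size.
move=> p_mon r_mon p_size r_size p_x r_x; apply: (map_poly_inj io).
by rewrite (key p) // (key r).
Qed.

End Frobenius.

(** * Irreducible compositions and degrees of roots *)

Lemma separable_roots (K : closedFieldType) (p : {poly K}) :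
    separable_poly p ->
  exists s : seq K, [/\ uniq s, size s = (size p).-1 &
                     forall x, (x \in s) = root p x].
Proof.
move=> p_sep; have p_neq0 := separable_poly_neq0 p_sep.
have [s pE] := closed_field_poly_normal p.
have lc_neq0 : lead_coef p != 0 by rewrite lead_coef_eq0.
exists s; split.
- by rewrite -separable_prod_XsubC -(eqp_separable (eqp_scale _ lc_neq0)) -pE.
- by rewrite pE size_scale // size_prod_XsubC.
by move=> x; rewrite pE rootZ // root_prod_XsubC.
Qed.

Lemma hcomp1 (F : fieldType) (g f : {poly F}) (n : nat) :
  (size f <= n.+1)%N -> hcomp g 1 n f = f \Po g.
Proof.
move=> f_size; rewrite /hcomp comp_polyE.
under eq_bigr do rewrite expr1n mulr1.
rewrite (big_ord_widen n.+1 (fun i => f`_i *: g ^+ i) f_size) [RHS]big_mkcond.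
apply: eq_bigr => i _; case: ltnP => // le_i.
by rewrite nth_default ?scale0r.
Qed.

Section Counting.

Variables (F : finFieldType) (K : closedFieldType) (io : {rmorphism F -> K}).
Hypothesis io_alg : integralRange io.
Local Notation degree := (degree io_alg).

(** The subfield with [q ^ N] elements, as an explicit list: every element
    counted below belongs to such a list. *)
Lemma frob_fixed_seq N : (0 < N)%N ->
  exists s : seq K, [/\ uniq s, size s = (#|F| ^ N)%N &
                     forall x, (x \in s) = (x ^+ (#|F| ^ N) == x)].
Proof.
move=> N_gt0; have q_gt1 : (1 < #|F|)%N by rewrite finNzRing_gt1.
have qN_gt1 : (1 < #|F| ^ N)%N.
  by rewrite -[1%N](exp1n N) ltn_exp2r.
have sizeE : size ('X^(#|F| ^ N) - 'X : {poly K}) = (#|F| ^ N).+1.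
  by rewrite size_polyDl ?size_polyXn // size_polyN size_polyX.
have q0 : (#|F| ^ N)%:R = 0 :> K.
  have pK : pdiv #|F| \in [pchar K].
    by apply: (pnatPpi (card_pchar_nat io)); rewrite pi_pdiv.
  by apply/eqP; rewrite -(dvdn_pcharf pK) dvdn_exp // pdiv_dvd.
have [|s [s_uniq s_size sE]] := @separable_roots K ('X^(#|F| ^ N) - 'X).
  rewrite unlock linearB /= derivXn derivX -mulr_natl -polyC_natr q0 mul0r sub0r.
  rewrite -[X in coprimep _ X]scaleN1r coprimepZr ?coprimep1 //.
  by rewrite oppr_eq0 oner_neq0.
exists s; split=> // [|x]; first by rewrite s_size sizeE.
by rewrite sE rootE !hornerE subr_eq0.
Qed.

(** Relate [f] in [Iset g 1 n] to [x] when [g.[x]] is a root of [f]. The [x]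
    related to [f] are the [e * n] conjugates of a root of the irreducible
    polynomial [f \Po g], and the only [f] related to [x] is the minimal
    polynomial of [g.[x]]. *)
Lemma card_Iset_comp (g : {poly F}) (n e : nat) (s : seq K) :
    size g = e.+1 -> (0 < e)%N -> (0 < n)%N -> uniq s ->
    (forall x, degree x = (e * n)%N -> x \in s) ->
  (#|Iset g 1 n| * (e * n) =
   count [pred x | (degree x == e * n) &&
                   (degree (map_poly io g).[x] == n)]%N s)%N.
Proof.
move=> g_size e_gt0 n_gt0 s_uniq s_full.
set B := [pred x | _ ]; rewrite -size_filter cardE -[RHS]muln1.
pose R (f : {poly_n.+1 F}) x :=
  root (map_poly io (f : {poly F})) (map_poly io g).[x].
have compE (f : {poly F}) x :
    root (map_poly io (f \Po g)) x = root (map_poly io f) (map_poly io g).[x].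
  by rewrite map_comp_poly !rootE horner_comp.
have comp_size (f : {poly F}) : size f = n.+1 -> size (f \Po g) = (e * n).+1.
  move=> f_size; have := size_comp_poly f g; rewrite f_size g_size /= mulnC => <-.
  rewrite prednK // size_poly_gt0; apply/negP => fg0.
  by have := size_comp_poly f g; rewrite f_size g_size (eqP fg0) size_poly0; nia.
have irrE (f : {poly F}) m x : size f = m.+1 -> root (map_poly io f) x ->
    irreducibleb f = (degree x == m).
  move=> f_size f_x; have f_neq0 : f != 0.
    by apply: contra_eq_neq f_size => ->; rewrite size_poly0.
  by rewrite (irreducible_degree io_alg f_neq0 f_x) f_size eqSS eq_sym.
have memI (f : {poly_n.+1 F}) : (f \in Iset g 1 n) =
    [&& size (f : {poly F}) == n.+1, (f : {poly F}) \is monic,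
        irreducibleb (f : {poly F}) & irreducibleb ((f : {poly F}) \Po g)].
  rewrite inE; case: (size (f : {poly F}) =P n.+1) => [f_size|]; last by [].
  by rewrite hcomp1.
apply: (double_count (R := R)) => [f | x].
  rewrite mem_enum memI => /and4P[/eqP f_size f_mon f_irr fg_irr].
  have fg_size := comp_size f f_size.
  have [x fg_x] : exists x, root (map_poly io ((f : {poly F}) \Po g)) x.
    by apply/closed_rootP; rewrite size_map_poly fg_size eqSS; lia.
  have x_deg : degree x = (e * n)%N.
    by apply/eqP; rewrite -(irrE _ _ _ fg_size fg_x).
  have conjE : map_poly io ((f : {poly F}) \Po g) %= conj_poly io_alg x.
    rewrite eqp_sym -dvdp_size_eqp ?conj_poly_dvdp //.
    by rewrite size_conj_poly size_map_poly fg_size x_deg.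
  rewrite -size_filter -x_deg.
  have -> : degree x = size (conjugates io_alg x) by rewrite size_map size_iota.
  apply/perm_size/uniq_perm; rewrite ?filter_uniq ?conjugates_uniq // => y.
  rewrite !mem_filter /R /= -compE (eqp_root conjE) root_prod_XsubC.
  case: (boolP (y \in _)) => //= y_conj.
  have fg_y : root (map_poly io ((f : {poly F}) \Po g)) y.
    by rewrite (eqp_root conjE) root_prod_XsubC.
  have y_deg : degree y = (e * n)%N.
    by apply/eqP; rewrite -(irrE _ _ _ fg_size fg_y).
  rewrite y_deg eqxx s_full // andbT.
  by rewrite -(irrE _ _ _ f_size) // -compE.
rewrite mem_filter => /andP[/= /andP[/eqP x_deg /eqP gx_deg] _].
have [p pE] := conj_polyP io_alg (map_poly io g).[x].
have p_root : root (map_poly io p) (map_poly io g).[x] by rewrite -pE root_conj_poly.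
have p_size : size p = n.+1 by rewrite -(size_map_poly io) -pE size_conj_poly gx_deg.
have p_mon : p \is monic by rewrite -(map_monic io) -pE conj_poly_monic.
have p_npoly : p \is a poly_of_size n.+1 by rewrite qualifE /= p_size.
have p_irr : irreducibleb p by rewrite (irrE _ _ _ p_size p_root) gx_deg.
have pg_irr : irreducibleb (p \Po g).
  by rewrite (irrE _ _ x (comp_size _ p_size)) ?compE // x_deg.
rewrite -size_filter -[RHS]/(size [:: NPoly p_npoly]).
apply/perm_size/uniq_perm; rewrite ?filter_uniq -?enumT ?enum_uniq // => f.
rewrite mem_filter mem_enum memI inE /R.
apply/andP/eqP => [[f_x /and4P[/eqP f_size f_mon _ _]] | ->]; last first.
  by split; rewrite //= p_size eqxx p_mon p_irr.
apply: val_inj.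
by apply: (monic_root_inj (io_alg := io_alg) _ _ _ _ f_x p_root); rewrite ?gx_deg.
Qed.

End Counting.

(** * Roots of irreducible cubics *)

Section Cubic.

Variables (F : finFieldType) (K : fieldType) (io : {rmorphism F -> K}).
Hypothesis io_alg : integralRange io.
Local Notation degree := (degree io_alg).
Variable g : {poly F}.
Hypothesis g_cubic : size g = 4%N.
Local Notation gK := (map_poly io g).

Lemma horner_frob x i : gK.[x ^+ (#|F| ^ i)] = gK.[x] ^+ (#|F| ^ i).
Proof.
rewrite -!(iter_frob io); elim: i => //= i <-.
by rewrite -[in LHS]map_frob_poly horner_map.
Qed.

(** With [d] the degree of [gK.[x]], the iterates of [x] under the [d]-th power
    of Frobenius are roots of [gK - gK.[x]%:P], so at most three of them are
    distinct. *)
Lemma degree_cubic x :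
  exists2 c, (0 < c < 4)%N & degree x = (c * degree gK.[x])%N.
Proof.
set d := degree gK.[x]; have d_gt0 : (0 < d)%N := degree_gt0 _ _.
have d_dv : (d %| degree x)%N.
  rewrite -degreeP -horner_frob; apply/eqP; congr _.[_]; apply/eqP.
  by rewrite (degreeP io_alg).
have iterE i : iter i (iter d (frob io)) x = x ^+ (#|F| ^ (i * d)).
  rewrite -(iter_frob io); elim: i => //= i ->.
  by rewrite mulSn iterD.
have p_size : size (gK - gK.[x]%:P) = 4%N.
  rewrite size_polyDl ?size_map_poly // size_polyN g_cubic.
  by rewrite (leq_ltn_trans (size_polyC_leq1 _)).
have [||i|i i_lt] := @iter_root_periodic _ (iter d (frob io)) (gK - gK.[x]%:P) x.
- exact/inj_iter/fmorph_inj.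
- by rewrite -size_poly_eq0 p_size.
- rewrite iterE rootE !hornerE horner_frob subr_eq0.
  by rewrite (degreeP io_alg) dvdn_mull.
rewrite p_size in i_lt; rewrite iterE => /eqP; rewrite (degreeP io_alg) => x_dv.
have [c cE] := dvdnP d_dv; exists c => //.
move: x_dv; rewrite cE dvdn_pmul2r // => /dvdn_leq c_le.
case/andP: i_lt => i_gt0 i_lt; rewrite (leq_ltn_trans (c_le i_gt0) i_lt) andbT.
by rewrite lt0n; apply/eqP => c0; have := degree_gt0 io_alg x; rewrite cE c0.
Qed.

(** For [g] of degree 3 and [0 < j], [x] is a root of some [g - a] which is
    irreducible over the field with [q ^ j] elements. *)
Definition cubic_nonsplit j x :=
  [&& gK.[x] ^+ (#|F| ^ j) == gK.[x], x ^+ (#|F| ^ j) != x &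
      x ^+ (#|F| ^ (3 * j)) == x].

(** [F(g(x))] has degree [d] over [F] and [F(x)] is a cubic extension of it. *)
Definition cubic_tower d x := (degree x == 3 * d)%N && (degree gK.[x] == d).

Lemma cubic_nonsplitE j x : (0 < j)%N ->
  cubic_nonsplit j x =
    [&& degree gK.[x] %| j, ~~ (3 %| j %/ degree gK.[x]) &
        degree x == 3 * degree gK.[x]]%N.
Proof.
move=> j_gt0; rewrite /cubic_nonsplit !(degreeP io_alg).
have d_gt0 := degree_gt0 io_alg gK.[x]; have [c c_lt ->] := degree_cubic x.
move: (degree _) d_gt0 => d d_gt0; case: (boolP (d %| j)%N) => //= /dvdnP[k jE].
rewrite jE mulnK // mulnA !dvdn_pmul2r // eqn_pmul2r //.
(* For [c = 1] or [c = 2], [c] divides [3 * k] if and only if it divides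
   [k]. *)
case: c c_lt => [|[|[|[|c]]]] //= _.
- by rewrite dvd1n andbF.
- by rewrite andbF Gauss_dvdr // andNb.
by rewrite dvdn_mulr ?andbT.
Qed.

(** A nonsplit [x] for [w * m] has [gK.[x]] of degree [D] dividing [w * m] with
    a cofactor prime to 3; hence [w %| D], and [D = w * d] for a unique
    divisor [d] of [m]. *)
Lemma count_cubic_nonsplit (s : seq K) (w m : nat) :
    3%N.-nat w -> (0 < m)%N -> ~~ (3 %| m)%N ->
  count (cubic_nonsplit (w * m)) s =
    (\sum_(d <- divisors m) count (cubic_tower (w * d)) s)%N.
Proof.
move=> w_3 m_gt0 m_3; have w_gt0 : (0 < w)%N by case/andP: w_3.
rewrite -sum1_count big_mkcond.
under [in RHS]eq_bigr do rewrite -sum1_count big_mkcond.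
rewrite exchange_big; apply: eq_bigr => x _ /=; rewrite -big_mkcond sum1_count /=.
rewrite cubic_nonsplitE ?muln_gt0 ?w_gt0 // /cubic_tower.
set D := degree gK.[x]; have D_gt0 : (0 < D)%N := degree_gt0 _ _.
case: ifP => [/and3P[D_dv t_3 /eqP ->] | nC].
  have w_dv : (w %| D)%N.
    rewrite -(@Gauss_dvdl w D (w * m %/ D)).
      by rewrite mulnC divnK // dvdn_mulr.
    have [k wE] := p_natP w_3.
    by rewrite {1}wE coprimeXl // prime_coprime.
  have [d0 DE] := dvdnP w_dv.
  rewrite (@eq_count _ _ (pred1 d0)) => [|d].
    rewrite count_uniq_mem ?divisors_uniq // -dvdn_divisors //.
    by move: D_dv; rewrite DE mulnC dvdn_pmul2l // => ->.
  by rewrite /= eqn_pmul2l // DE mulnC eqn_pmul2l // andbb eq_sym.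
apply/esym/eqP; rewrite -leqn0 leqNgt -has_count; apply/hasPn => d.
rewrite -dvdn_divisors // => d_dv; apply: contraFN nC => /andP[/eqP -> /eqP ->].
rewrite eqxx andbT dvdn_pmul2l // d_dv divnMl //=.
by apply: contra m_3 => /dvdn_trans; apply; exact: dvdn_div.
Qed.

End Cubic.

(** * The Dickson parametrization in characteristic 2 *)

(** The exponents that kill [u] form an ideal of the integers. *)
Lemma expz_comb (K : fieldType) (u : K) (a b s t c : int) :
    u != 0 -> u ^ a = 1 -> u ^ b = 1 -> c = a * s + b * t -> u ^ c = 1.
Proof.
by move=> u0 ua ub ->; rewrite expfzDr // -!exprz_exp ua ub !exp1rz mulr1.
Qed.

Lemma addV_eq (K : fieldType) (u v : K) : u != 0 -> v != 0 ->
  (u + u^-1 == v + v^-1) = (u == v) || (u == v^-1).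
Proof.
move=> u0 v0; rewrite -subr_eq0 -(mulIr_eq0 _ (mulIf u0)).
have -> : (u + u^-1 - (v + v^-1)) * u = (u - v) * (u - v^-1).
  by field; rewrite u0 v0.
by rewrite mulf_eq0 !subr_eq0.
Qed.

Section Dickson.

Variable K : fieldType.
Hypothesis char2 : 2 \in [pchar K].

(** Raising to the power [Q] maps [u + u^-1] to [u ^ Q + u ^ - Q], which is the
    same sum if and only if [u ^ Q] is [u] or [u^-1]. The sign [e] only
    exchanges the two cases. *)
Lemma addV_fixed (u : K) (Q : nat) (e : int) :
    u != 0 -> [pchar K].-nat Q -> e = 1 \/ e = -1 ->
  ((u + u^-1) ^+ Q == u + u^-1) =
    (u ^ (Q%:Z - e) == 1) || (u ^ (Q%:Z + e) == 1).
Proof.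
move=> u0 Q_pchar; rewrite exprDn_pchar // exprVn addV_eq ?expf_neq0 //.
have -> : (u ^+ Q == u) = (u ^ (Q%:Z - 1) == 1).
  rewrite expfzDr // exprN1 -exprnP; apply/eqP/eqP => [-> | uQ].
    by rewrite divff.
  by rewrite -[LHS](divfK u0) uQ mul1r.
have -> : (u ^+ Q == u^-1) = (u ^ (Q%:Z + 1) == 1).
  rewrite expfzDr // expr1z -exprnP; apply/eqP/eqP => [-> | uQ].
    by rewrite mulVf.
  by rewrite -[LHS](mulfK u0) uQ mul1r.
by case=> ->; rewrite ?opprK // orbC.
Qed.

(** With [y = z + z^-1], the left-hand side is [y ^+ 3 + y] in characteristic 2,
    and [y ^+ 3 = z ^+ 3 + z ^- 3 + 3 * y]. *)
Lemma cubic_addV (z : K) : z != 0 ->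
  (1 + z + z^-1) ^+ 3 + (1 + z + z^-1) ^+ 2 = z ^+ 3 + (z ^+ 3)^-1.
Proof.
move=> z0; pose y := z + z^-1; pose E := 2 * y + y ^+ 2 + (1 + y) ^+ 2.
have -> : (1 + z + z^-1) ^+ 3 + (1 + z + z^-1) ^+ 2 =
          z ^+ 3 + (z ^+ 3)^-1 + E *+ 2.
  by rewrite /E /y; field.
by rewrite mulrn_pchar // addr0.
Qed.

(** In characteristic 2, [z ^+ 6 - 1] is the square of [z ^+ 3 - 1]. *)
Lemma expz6_eq1 (z : K) (e : int) : e = 1 \/ e = -1 ->
  z ^ (6 * e) = 1 -> z ^+ 3 = 1.
Proof.
move=> e1 z6; have {}z6 : z ^+ 6 = 1.
  case: e1 z6 => ->; rewrite ?mulr1 ?mulrN1 // => /(congr1 GRing.inv).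
  by rewrite invr1 invr_expz opprK.
have : (z ^+ 3 - 1) * (z ^+ 3 + 1) = 0.
  by rewrite -subr_sqr expr1n -exprM z6 subrr.
rewrite -{2}[1](oppr_pchar2 char2) => /eqP.
by rewrite mulf_eq0 orbb subr_eq0 => /eqP.
Qed.

(** By [addV_fixed], [a] is fixed when [z ^ (3 * (Q - e)) = 1] or
    [z ^ (3 * (Q + e)) = 1]. In the second case 3 is prime to [Q + e], and [x]
    is fixed by the power [Q ^ 3] only if it is already fixed by the power [Q]:
    otherwise its cubic has one root in the field with [Q] elements and two in
    the quadratic extension of that field. *)
Lemma cubic_addV_nonsplit (z : K) (Q : nat) (e t : int) :
    z != 0 -> [pchar K].-nat Q -> e = 1 \/ e = -1 -> Q%:Z = e + 3 * t ->
    let x := 1 + z + z^-1 in let a := z ^+ 3 + (z ^+ 3)^-1 in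
  [&& a ^+ Q == a, x ^+ Q != x & x ^+ (Q ^ 3) == x] =
    (z ^ (3 * (Q%:Z - e)) == 1) && (z ^ (Q%:Z - e) != 1).
Proof.
move=> z0 Q_pchar e1 QE /=.
have xE n : [pchar K].-nat n ->
    ((1 + z + z^-1) ^+ n == 1 + z + z^-1) =
    (z ^ (n%:Z - e) == 1) || (z ^ (n%:Z + e) == 1).
  move=> n_pchar; rewrite -!addrA exprDn_pchar // expr1n (inj_eq (addrI 1)).
  exact: addV_fixed.
have Q3_pchar : [pchar K].-nat (Q ^ 3)%N by rewrite pnatX Q_pchar.
rewrite !xE // (addV_fixed _ Q_pchar e1) ?expf_neq0 // !exprnP !exprz_exp.
rewrite (_ : Posz (Q ^ 3) = Q%:Z ^+ 3); last by rewrite -!natz natrX.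
rewrite -[Posz 3]/(3 : int).
have t_eq : Q%:Z - e = 3 * t by rewrite QE; ring.
have cube1 : z ^+ 3 = 1 -> z ^ (Q%:Z - e) = 1.
  by rewrite t_eq -exprz_exp => z3; rewrite -[z ^ 3]/(z ^+ 3) z3 exp1rz.
(* Since [Q = e + 3 t] and [e ^ 2 = 1], the coefficients below come from
   [Q ^ 3 - e = 3 (Q - e) (1 + 3 e t + 3 t ^ 2)] and
   [Q ^ 3 + e = (Q + e) (3 t Q + 1)]. *)
have f1 : z ^ (3 * (Q%:Z - e)) = 1 -> z ^ (Q%:Z ^+ 3 - e) = 1.
  move=> H; apply: (@expz_comb _ _ _ _ (1 + 3 * e * t + 3 * t ^+ 2) 0 _ z0 H H).
  by case: e1 QE => -> ->; ring.
have f2 : z ^ (3 * (Q%:Z - e)) = 1 -> z ^ (Q%:Z + e) = 1 -> z ^ (Q%:Z - e) = 1.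
  move=> H1 H2; apply/cube1/(expz6_eq1 e1).
  by apply: (@expz_comb _ _ _ _ (-1) 3 _ z0 H1 H2); ring.
have f3 : z ^ (3 * (Q%:Z + e)) = 1 -> z ^ (Q%:Z ^+ 3 + e) = 1 ->
    z ^ (Q%:Z + e) = 1.
  move=> H1 H2; apply: (@expz_comb _ _ _ _ (- t * Q%:Z) 1 _ z0 H1 H2).
  by case: e1 QE => -> ->; ring.
have f4 : z ^ (3 * (Q%:Z + e)) = 1 -> z ^ (Q%:Z ^+ 3 - e) = 1 ->
    z ^ (Q%:Z - e) = 1.
  move=> H1 H2; apply/cube1/(expz6_eq1 e1).
  apply: (@expz_comb _ _ _ _ (3 * t * Q%:Z + 1) (-3) _ z0 H1 H2).
  by case: e1 QE => -> ->; ring.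
apply/idP/idP => [/and3P[/orP[]/eqP z1] | /andP[/eqP z1 z2]].
- by rewrite negb_or => /andP[z2 _] _; rewrite z1 eqxx.
- rewrite negb_or => /andP[z2 z3] /orP[]/eqP z4.
    by rewrite (f4 z1 z4) eqxx in z2.
  by rewrite (f3 z1 z4) eqxx in z3.
apply/and3P; split; [by rewrite z1 eqxx | | by rewrite (f1 z1) eqxx].
rewrite negb_or z2 /=; apply: contra z2 => /eqP z3.
by rewrite (f2 z1 z3).
Qed.

End Dickson.

Lemma addV_surj (K : closedFieldType) (y : K) :
  exists2 z, z != 0 & y = z + z^-1.
Proof.
have p_size : size ('X^2 - y *: 'X + 1 : {poly K}) = 3%N.
  rewrite -addrA size_polyDl size_polyXn //.
  rewrite (leq_ltn_trans (size_polyD _ _)) // gtn_max size_polyN size_poly1 andbT.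
  by rewrite (leq_ltn_trans (size_scale_leq _ _)) // size_polyX.
have [|z] := closed_rootP ('X^2 - y *: 'X + 1 : {poly K}) _.
  by rewrite p_size.
rewrite rootE !hornerE => /eqP z_root.
have z0 : z != 0.
  by apply: contra_eq_neq z_root => ->; rewrite expr0n mulr0 subr0 add0r oner_neq0.
exists z => //; apply: (mulIf z0); rewrite mulrDl mulVf //.
by apply/eqP; rewrite -subr_eq0 -oppr_eq0 -z_root; apply/eqP; ring.
Qed.

Lemma unity_roots (K : closedFieldType) (n : nat) : n%:R != 0 :> K ->
  exists s : seq K, [/\ uniq s, size s = n &
                     forall z, (z \in s) = (z ^+ n == 1)].
Proof.
move=> n0; have n_gt0 : (0 < n)%N by rewrite lt0n; apply: contra_neq n0 => ->.
have [s [s_uniq s_size sE]] := separable_roots (separable_Xn_sub_1 n0).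
exists s; split=> // [|z]; first by rewrite s_size size_XnsubC.
by rewrite sE rootE !hornerE subr_eq0.
Qed.

(** * The count *)

(** The map [z |-> 1 + z + z^-1] is two-to-one from the [3 * M - M] elements
    with [z ^+ (3 * M) = 1] and [z ^+ M != 1], where [M = Q - e], onto the nonsplit
    elements. Its fibres [z, z^-1] have two elements because in characteristic 2
    only [1] is its own inverse. *)
Lemma card_cubic_nonsplit (F : finFieldType) (K : closedFieldType)
    (io : {rmorphism F -> K}) (s : seq K) (j : nat) (e t : int) :
    2 \in [pchar K] -> uniq s -> (0 < j)%N ->
    (forall x : K, x ^+ (#|F| ^ (3 * j)) = x -> x \in s) ->
    e = 1 \/ e = -1 -> (#|F| ^ j)%N%:Z = e + 3 * t ->
  (count (cubic_nonsplit io ('X^3 + 'X^2) j) s)%:Z = (#|F| ^ j)%N%:Z - e.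
Proof.
move=> char2 s_uniq j_gt0 s_full e1 QE; set Q := (#|F| ^ j)%N in QE *.
pose nonsplit := cubic_nonsplit io ('X^3 + 'X^2) j.
have Q_pchar : [pchar K].-nat Q by rewrite pnatX card_pchar_nat.
have Q_gt1 : (1 < Q)%N by rewrite -[1%N](exp1n j) ltn_exp2r // finNzRing_gt1.
have Q_even : ~~ odd Q.
  have /p_natP[[|r] rE] : 2%N.-nat Q; last by rewrite rE oddX.
    by rewrite -(eq_pnat _ (pcharf_eq char2)).
  by rewrite rE in Q_gt1.
have [M [M_gt0 M_odd ME]] : exists M, [/\ (0 < M)%N, odd M & M%:Z = Q%:Z - e].
  by case: e1 => ->; [exists Q.-1 | exists Q.+1]; split; lia.
have natK_neq0 i : odd i -> i%:R != 0 :> K.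
  by rewrite -(dvdn_pcharf char2) dvdn2 => ->.
have [s1 [s1_uniq s1_size s1E]] := unity_roots (natK_neq0 M M_odd).
have [|s3 [s3_uniq s3_size s3E]] := @unity_roots K (3 * M).
  by apply: natK_neq0; rewrite oddM M_odd.
have nonsplitE z : z != 0 ->
    nonsplit (1 + z + z^-1) = (z \in s3) && (z ^+ M != 1).
  move=> z0; rewrite /nonsplit /cubic_nonsplit.
  rewrite rmorphD /= !map_polyXn hornerD !hornerXn cubic_addV //.
  rewrite [(3 * j)%N]mulnC expnM -/Q.
  rewrite (cubic_addV_nonsplit char2 z0 Q_pchar e1 QE) -ME s3E.
  by rewrite -[3 * M%:Z]/((3 * M)%N%:Z).
pose Z := [seq z <- s3 | z ^+ M != 1]; pose T := [seq x <- s | nonsplit x].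
have Z_neq0 z : z \in Z -> z != 0.
  rewrite mem_filter s3E => /andP[_ /eqP z3]; apply: contra_eq_neq z3 => ->.
  by rewrite expr0n muln_eq0 -[M == 0]leqn0 leqNgt M_gt0 eq_sym oner_neq0.
have Z_size : size Z = (M * 2)%N.
  have := count_predC (fun z => z ^+ M == 1) s3.
  have -> : count (fun z => z ^+ M == 1) s3 = M.
    rewrite -size_filter -s1_size; apply/perm_size/uniq_perm => // [|z].
      exact: filter_uniq.
    rewrite mem_filter s1E s3E mulnC exprM.
    rewrite s1_size; case: (z ^+ M =P 1) => // ->.
    by rewrite expr1n eqxx.
  by rewrite size_filter s3_size; move: (count _ _) => c; lia.
have ZE z : z \in Z = (z != 0) && nonsplit (1 + z + z^-1).
  apply/idP/andP => [zZ | [z0]]; last by rewrite nonsplitE // mem_filter andbC.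
  by rewrite Z_neq0 // nonsplitE ?Z_neq0 //; move: zZ; rewrite mem_filter andbC.
have TE x : x \in T = nonsplit x.
  rewrite mem_filter; case: (boolP (nonsplit x)) => //=.
  by case/and3P=> _ _ /eqP /s_full.
have : (size Z * 1 = size T * 2)%N.
  apply: (double_count (R := fun z x => x == 1 + z + z^-1)) => [z | x].
    rewrite ZE => /andP[z0 zC].
    by rewrite (@count_uniq_mem _ T (1 + z + z^-1)) ?filter_uniq // TE zC.
  rewrite TE => xC; have [z z0] := addV_surj (x - 1).
  move=> /(canRL (subrK _)); rewrite addrC addrA => xE.
  have zZ : z \in Z by rewrite ZE z0 -xE.
  have zVZ : z^-1 \in Z by rewrite ZE invr_eq0 z0 invrK addrAC -xE.
  rewrite -size_filter -[RHS]/(size [:: z; z^-1]).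
  apply/perm_size/uniq_perm => [||y]; rewrite ?filter_uniq //.
    rewrite /= andbT inE; apply/eqP => zV.
    have zz : z ^+ 2 = 1 by rewrite expr2 {2}zV mulfV.
    move: zZ; rewrite mem_filter => /andP[/eqP[]].
    have -> : z = 1.
      apply/eqP; rewrite -subr_eq0 -[_ == 0]orbb -mulf_eq0.
      rewrite -{2}(oppr_pchar2 char2 1) opprK.
      by rewrite -subr_sqr expr1n zz subrr.
    by rewrite expr1n.
  rewrite mem_filter !inE; apply/andP/orP => [[yx yZ] | yz].
    move: yx; rewrite xE -!addrA (inj_eq (addrI 1)) addV_eq ?Z_neq0 //.
    rewrite (eq_sym z) => /orP[] yz; [by left | right].
    by rewrite -(inj_eq invr_inj) invrK eq_sym.
  by case: yz => /eqP ->; rewrite ?invrK ?[1 + z^-1 + z]addrAC xE.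
rewrite muln1 Z_size => /eqP; rewrite eqn_pmul2r // => /eqP M_eq.
by rewrite -size_filter -[size _]M_eq.
Qed.

Theorem theorem20 (F : finFieldType) (q k n : nat)
    (hF : #|F| = q) (hq : q = (2 ^ k)%N) (hn : (1 < n)%N) :
  #|Iset ('X^3 + 'X^2 : {poly F}) 1 n|%:R =
    (3 * n`_3)%N%:R^-1 *
      (Inum (n %/ n`_3)%N (q%:Z ^+ (n`_3)%N) -
       Inum (n %/ n`_3)%N (legendre q 3)) :> rat.
Proof.
have char2F : 2 \in [pchar F] by apply: (@card_finPcharP _ 2 k); rewrite ?hF.
have [K [io io_alg]] := countable_algebraic_closure F.
have char2 : 2 \in [pchar K] by rewrite (fmorph_pchar io).
have n_gt0 : (0 < n)%N by exact: ltnW.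
set w := (n`_3)%N; set m := (n %/ w)%N; set eps := legendre q 3.
have nE : n = (w * m)%N by rewrite mulnC divnK ?dvdn_part.
have w_gt0 : (0 < w)%N := part_gt0 _ _.
have m_gt0 : (0 < m)%N by move: n_gt0; rewrite nE muln_gt0 => /andP[].
have m_3 : ~~ (3 %| m)%N.
  have : 3%N^'.-nat m.
    by rewrite /m -{1}(partnC 3%N n_gt0) mulKn ?part_pnat.
  by rewrite p'natE.
have w_3 : 3%N.-nat w := part_pnat _ _.
have w_odd : odd w by have [r ->] := p_natP w_3; rewrite oddX orbT.
have [eps1 [t0 qE]] : (eps = 1 \/ eps = -1) /\ exists t, q%:Z = eps + 3 * t.
  have : (q %% 3 < 3)%N by rewrite ltn_mod.
  have q3 := divn_eq q 3; have : ~~ (3 %| q)%N by rewrite hq Euclid_dvdX.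
  rewrite /dvdn; case qm : (q %% 3)%N q3 => [|[|[|r]]] //= q3 _ _.
    rewrite /eps (@legendre3_1 q) ?qm //; split; first by left.
    by exists (q %/ 3)%N%:Z; lia.
  rewrite /eps (@legendre3_2 q) ?qm //; split; first by right.
  by exists ((q %/ 3)%N%:Z + 1); lia.
have qXE i : exists t, (q ^ i)%N%:Z = eps ^+ i + 3 * t.
  elim: i => [|i [t IH]]; first by exists 0; rewrite expn0 expr0 mulr0 addr0.
  exists (t0 * eps ^+ i + q%:Z * t).
  by rewrite expnS PoszM IH exprS qE; ring.
have epsX i : eps ^+ i = 1 \/ eps ^+ i = -1.
  case: eps1 => ->; first by left; rewrite expr1n.
  by rewrite -signr_odd; case: (odd i); [right | left].
(* [w] is odd, as a power of 3. *)
have epsw i : eps ^+ (w * i) = eps ^+ i.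
  rewrite exprM; congr (_ ^+ _).
  by case: eps1 => ->; rewrite ?expr1n // -signr_odd w_odd.
(* All the elements to be counted have a degree dividing [3 * n]. *)
have [|s [s_uniq _ sE]] := @frob_fixed_seq F K io (3 * n).
  by rewrite muln_gt0.
have g_size : size ('X^3 + 'X^2 : {poly F}) = 4%N.
  by rewrite size_polyDl ?size_polyXn.
pose b d := (count (cubic_tower io_alg ('X^3 + 'X^2) (w * d)) s)%:Z.
pose c j := (q ^ (w * j))%N%:Z - eps ^+ j.
have bE : (#|Iset ('X^3 + 'X^2 : {poly F}) 1 n| * (3 * n))%N%:Z = b m.
  rewrite (card_Iset_comp (io_alg := io_alg) g_size (s := s)) // => [|x x_deg].
    by rewrite /b -nE.
  by rewrite sE (degreeP io_alg) x_deg.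
have cE j : (j %| m)%N -> c j = \sum_(d <- divisors j) b d.
  move=> j_dv; have j_gt0 := dvdn_gt0 m_gt0 j_dv.
  have j_3 : ~~ (3 %| j)%N by apply: contra m_3 => /dvdn_trans; exact.
  have [t tE] := qXE (w * j)%N; rewrite epsw in tE.
  rewrite -(big_morph Posz PoszD (erefl _)).
  rewrite -(count_cubic_nonsplit io_alg g_size s w_3 j_gt0 j_3).
  rewrite (@card_cubic_nonsplit F K io s _ _ t char2 s_uniq _ _ (epsX j)) ?hF //.
    by rewrite muln_gt0 w_gt0.
  move=> x /eqP; rewrite sE -hF !(degreeP io_alg) => /dvdn_trans; apply.
  by rewrite nE !dvdn_pmul2l.
have := mobius_inversion m_gt0 cE; rewrite -bE => invE.
rewrite /Inum -mulrBr -rmorphB /= -sumrB.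
have -> : \sum_(d <- divisors m) (mobius d * (q%:Z ^+ w) ^+ (m %/ d) -
            mobius d * eps ^+ (m %/ d)) =
          (#|Iset ('X^3 + 'X^2 : {poly F}) 1 n| * (3 * n))%N%:Z.
  rewrite -invE; apply: eq_bigr => d _.
  by rewrite -mulrBr /c -exprM -[in RHS]natz natrX natz.
rewrite -pmulrn nE !natrM.
have w0 : w%:R != 0 :> rat by rewrite Num.Theory.pnatr_eq0 -lt0n.
have m0 : m%:R != 0 :> rat by rewrite Num.Theory.pnatr_eq0 -lt0n.
by field; rewrite w0 m0.
Qed.
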